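(* Let $\{(X_i,\mathcal U_i):i\in I\}$ be a family of $g$-quasi uniform spaces with $I\neq\emptyset$, and let $(X,\mathcal U)$ be its product $g$-quasi uniform space. Then $(X,\mathcal U)$ is strongly Lebesgue if and only if $(X_i,\mathcal U_i)$ is strongly Lebesgue for every $i\in I$.
   Context: A $g$-quasi uniformity (generalized quasi-uniformity) on a nonempty set $Z$ is a nonempty collection $\mathcal V\subset\mathcal P(Z\times Z)$ such that (i) $\Delta(Z)=\{(z,z):z\in Z\}\subset U$ for all $U\in\mathcal V$; (ii) $U\in\mathcal V$ and $U\subset V\subset Z\times Z$ imply $V\in\mathcal V$; (iii) for each $U\in\mathcal V$ there is $V\in\mathcal V$ with $V\circ V\subset U$, where $V\circ V=\{(x,z):\exists y,\ (x,y)\in V,(y,z)\in V\}$. (Closure under intersection is not required.) The pair $(Z,\mathcal V)$ is called a $g$-quasi uniform space. Product: for a family $\{(X_i,\mathcal U_i):i\in I\}$ of $g$-quasi uniform spaces, let $X=\prod_{i\in I}X_i$ with projections $\pi_i:X\to X_i$. The product $g$-quasi uniformity $\mathcal U$ on $X$ is the one with base $\{(\pi_i\times\pi_i)^{-1}(U_i):U_i\in\mathcal U_i,\ i\in I\}$, i.e. $\mathcal U=\{V\subset X\times X: (\pi_i\times\pi_i)^{-1}(U_i)\subset V\text{ for some }i\in I,\ U_i\in\mathcal U_i\}$ (no finite intersections are taken). $(X,\mathcal U)$ is the product $g$-quasi uniform space. For $U\in\mathcal V$ and $x\in Z$ put $U(x)=\{y\in Z:(x,y)\in U\}$. The collection $\mu(\mathcal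 V)=\{G\subset Z: \text{for every }x\in G\text{ there is }U\in\mathcal V\text{ with }U(x)\subset G\}$ is the induced supratopology. A generalized neighborhood of $a\in Z$ is a set $A\subset Z$ with $a\in G\subset A$ for some $G\in\mu(\mathcal V)$. A net $(S_n)_{n\in D}$ in $Z$ is a map from a directed set $(D,\ge)$ to $Z$. A point $c\in Z$ is a cluster point of the net if for every generalized neighborhood $A$ of $c$ and every $n\in D$ there is $m\in D$ with $m\ge n$ and $S_m\in A$. The net is pseudo-Cauchy if for every $U\in\mathcal V$ and $p\in D$ there exist $m,n\in D$ with $m\neq n$, $m,n\ge p$ and $(S_m,S_n)\in U$. $(Z,\mathcal V)$ is strongly Lebesgue if every pseudo-Cauchy net in $Z$ has a cluster point in $Z$. *)

(* Defs.v *)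
From mathcomp Require Import all_boot.
From mathcomp Require Import boolp classical_sets.

Set Implicit Arguments.
Unset Strict Implicit.
Unset Printing Implicit Defensive.

Local Open Scope classical_set_scope.
Local Open Scope relation_scope.

(* A quasi-uniformity (no symmetry axiom) that need not be closed under finite
   intersections. *)
Record gquasi_uniformity (Z : Type) (V : set_system (Z * Z)) : Prop :=
  GQuasiUniformity {
    gqu_carrier_nonempty : [set: Z] !=set0 ;
    gqu_nonempty : V !=set0 ;
    gqu_refl : forall A, V A -> diagonal `<=` A ;
    gqu_upward : forall A B, V A -> A `<=` B -> V B ;
    gqu_split : forall A, V A -> exists2 B, V B & B \; B `<=` A
  }.

Definition product_gqu (I : Type) (X : I -> Type)
    (U : forall i, set_system (X i * X i)) :
    set_system ((forall i, X i) * (forall i, X i)) :=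
  [set V | exists i, exists2 W, U i W &
    (fun p : (forall i, X i) * (forall i, X i) => (p.1 i, p.2 i)) @^-1` W
      `<=` V].

Definition supratopology (Z : Type) (V : set_system (Z * Z)) : set_system Z :=
  [set G | forall x, G x -> exists2 A, V A & xsection A x `<=` G].

Definition gnbhs (Z : Type) (V : set_system (Z * Z)) (a : Z) : set_system Z :=
  [set A | exists G, [/\ supratopology V G, G a & G `<=` A]].

(* [ge m n] reads "m >= n". Antisymmetry is not required. *)
Record directed (D : Type) (ge : D -> D -> Prop) : Prop := Directed {
  directed_nonempty : [set: D] !=set0 ;
  directed_refl : forall n, ge n n ;
  directed_trans : forall m n p, ge m n -> ge n p -> ge m p ;
  directed_ub : forall m n, exists2 p, ge p m & ge p n
}.

Definition cluster_point (Z : Type) (V : set_system (Z * Z))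
    (D : Type) (ge : D -> D -> Prop) (S : D -> Z) (c : Z) : Prop :=
  forall A, gnbhs V c A -> forall n, exists2 m, ge m n & A (S m).

Definition pseudo_cauchy (Z : Type) (V : set_system (Z * Z))
    (D : Type) (ge : D -> D -> Prop) (S : D -> Z) : Prop :=
  forall A, V A -> forall p,
    exists m n, [/\ m <> n, ge m p, ge n p & A (S m, S n)].

Definition strongly_lebesgue (Z : Type) (V : set_system (Z * Z)) : Prop :=
  forall (D : Type) (ge : D -> D -> Prop) (S : D -> Z),
    directed ge -> pseudo_cauchy V ge S -> exists c, cluster_point V ge S c.

Lemma product_gquP (I : Type) (X : I -> Type)
    (U : forall i, set_system (X i * X i)) :
  [set: I] !=set0 -> (forall i, gquasi_uniformity (U i)) ->
  gquasi_uniformity (product_gqu U).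
Proof.
move=> [i0 _] HU; split.
- have c i : {x : X i | [set: X i] x}.
    exact/cid/(gqu_carrier_nonempty (HU i)).
  by exists (fun i => sval (c i)).
- have [W UW] := gqu_nonempty (HU i0).
  by exists ((fun p => (p.1 i0, p.2 i0)) @^-1` W); exists i0; exists W.
- move=> A [i [W UW WA]] [x y] /diagonalP ->; apply: WA => /=.
  exact/(gqu_refl (HU i) UW)/diagonalP.
- move=> A B [i [W UW WA]] AB; exists i; exists W => //.
  exact: subset_trans WA AB.
- move=> A [i [W UW WA]]; have [W' UW' W'W] := gqu_split (HU i) UW.
  exists ((fun p => (p.1 i, p.2 i)) @^-1` W'); first by exists i; exists W'.
  move=> [x y] [z /= xz zy]; apply: WA; apply: W'W.
  by exists (z i).
Qed.

(* Main.v *)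
Require Import Defs.
From mathcomp Require Import all_boot.
From mathcomp Require Import boolp classical_sets.

Local Open Scope classical_set_scope.

(** Both notions in the strong Lebesgue property can be read one coordinate at a
    time, because every basic entourage of the product constrains a single
    coordinate.

    A net in the product is pseudo-Cauchy if and only if all its coordinate nets
    are ([pseudo_cauchy_product]).  Moreover a point whose coordinates are
    cluster points of the coordinate nets is a cluster point of the net, and
    conversely ([cluster_point_product]): for a topological product this would
    fail, since a neighborhood there constrains finitely many coordinates
    simultaneously, and different coordinates may cluster along different
    subnets.  The splitting axiom enters here, in [gnbhs_xsection], to see that
    the sections of an entourage are generalized neighborhoods.

    If all factors are strongly Lebesgue, cluster points of the coordinate nets
    are therefore assembled by choice.  Conversely, a pseudo-Cauchy net in one
    factor is lifted to the product by freezing all other coordinates at a base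
    point; a constant coordinate satisfies every entourage by reflexivity, so
    the lifted net is pseudo-Cauchy, and its cluster point projects to one of
    the given net. *)

(** The set of points having some section inside [xsection A x] is a
    supratopologically open core of [xsection A x]: if [B \; B] is contained in
    an entourage witnessing that [y] lies in the core, then [B] itself witnesses
    it for all points of [xsection B y]. *)
Lemma gnbhs_xsection (Z : Type) (V : set_system (Z * Z)) (A : set (Z * Z))
    (x : Z) :
  gquasi_uniformity V -> V A -> gnbhs V x (xsection A x).
Proof.
move=> HV VA.
exists [set y | exists2 B, V B & xsection B y `<=` xsection A x]; split.
- move=> y [B VB ByA]; have [C VC CB] := gqu_split HV VB.
  exists C => // z /xsectionP yz; exists C => // t /xsectionP zt.
  by apply: ByA; apply/xsectionP; apply: CB; exists z.
- by exists A.
- move=> y [B VB]; apply; apply/xsectionP.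
  exact/(gqu_refl HV VB)/diagonalP.
Qed.

Section Product.

Context (I : Type) (X : I -> Type) (U : forall i, set_system (X i * X i)).
Context (D : Type) (ge : D -> D -> Prop).

Lemma pseudo_cauchy_product (S : D -> forall i, X i) :
  pseudo_cauchy (product_gqu U) ge S <->
  forall i, pseudo_cauchy (U i) ge (fun n => S n i).
Proof.
split=> [cS i W UW p|cS A [i [W UW WA]] p].
  have PW : product_gqu U ((fun q => (q.1 i, q.2 i)) @^-1` W).
    by exists i; exists W.
  exact: cS PW p.
have [m [n [mn mp np Wmn]]] := cS i W UW p.
by exists m, n; split=> //; exact: WA.
Qed.

Lemma gnbhs_product (i : I) (c : forall i, X i) (A : set (X i)) :
  gnbhs (U i) (c i) A -> gnbhs (product_gqu U) c ((fun x => x i) @^-1` A).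
Proof.
move=> [G [oG Gc GA]]; exists ((fun x => x i) @^-1` G); split=> //.
- move=> x /oG[W UW WG].
  exists ((fun q => (q.1 i, q.2 i)) @^-1` W); first by exists i; exists W.
  by move=> y /xsectionP xy; apply: WG; apply/xsectionP.
- by move=> x /GA.
Qed.

Lemma cluster_point_product (S : D -> forall i, X i) (c : forall i, X i) :
  (forall i, gquasi_uniformity (U i)) ->
  cluster_point (product_gqu U) ge S c <->
  forall i, cluster_point (U i) ge (fun n => S n i) (c i).
Proof.
move=> HU; split=> [cS i A /gnbhs_product nA n|cS A [G [oG Gc GA]] n].
  exact: cS nA n.
have [V [i [W UW WV]] VG] := oG _ Gc.
have [m mn /xsectionP Wm] := cS i _ (gnbhs_xsection _ _ _ (c i) (HU i) UW) n.
exists m => //; apply/GA/VG/xsectionP.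
exact: WV.
Qed.

End Product.

Theorem theorem4p5 (I : Type) (X : I -> Type)
    (U : forall i : I, set_system (X i * X i))
    (I_nonempty : [set: I] !=set0)
    (U_gqu : forall i : I, gquasi_uniformity (U i)) :
  strongly_lebesgue (product_gqu U) <->
  forall i : I, strongly_lebesgue (U i).
Proof.
split=> [LU i D ge S dD cS|LU D ge S dD /pseudo_cauchy_product cS]; last first.
  have c i : {x | cluster_point (U i) ge (fun n => S n i) x}.
    exact/cid/(LU i _ _ _ dD (cS i)).
  exists (fun i => sval (c i)); apply/cluster_point_product => // i.
  exact: svalP.
have x0 j : X j by have [x _] := cid (gqu_carrier_nonempty (U_gqu j)).
pose T n := @dfwith {classic I} X x0 i (S n).
have Ti n : T n i = S n by exact: (@dfwith_in {classic I}).
have cT : pseudo_cauchy (product_gqu U) ge T.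
  apply/pseudo_cauchy_product => j W UW p.
  have [ij|ij] := pselect (i = j).
    case: _ / ij W UW => W UW.
    by have [m [n mnW]] := cS W UW p; exists m, n; rewrite !Ti.
  (* Any entourage of the i-th factor yields two distinct late indices. *)
  have [W0 UW0] := gqu_nonempty (U_gqu i).
  have [m [n [mn mp np _]]] := cS W0 UW0 p.
  have Tj k : T k j = x0 j by apply: (@dfwith_out {classic I}); apply/eqP.
  exists m, n; split=> //; rewrite !Tj.
  exact/(gqu_refl (U_gqu j) UW)/diagonalP.
have [c /cluster_point_product cc] := LU _ _ _ dD cT.
have {}cc := cc U_gqu i.
exists (c i) => A nA n; have [m mn] := cc A nA n.
by rewrite Ti; exists m.
Qed.
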